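(* Let $P$ be either the triakis octahedron or the deltoidal icositetrahedron, and let $\mathcal T$ be a set of tile designs for $P$ with symmetry group the full octahedral group $O_h$ (order $48$). Suppose there are $t_{\mathrm{id}}$ tiles, of which $t_f$ are fixed under the (horizontal) reflection of the face. Then the number of ways of tiling the faces of $P$ up to full octahedral symmetry $O_h$ is (in both cases) $$\frac{1}{48}\left(t_{\mathrm{id}}^{24}+6t_{\mathrm{id}}^6+3t_{\mathrm{id}}^{12}+8t_{\mathrm{id}}^8+6t_{\mathrm{id}}^{12}+t_{\mathrm{id}}^{12}+6t_{\mathrm{id}}^6+3t_{\mathrm{id}}^{12}+8t_{\mathrm{id}}^4+6t_{\mathrm{id}}^{10}t_f^4\right)$$ $$=\frac{1}{48}\left(t_{\mathrm{id}}^{24}+13t_{\mathrm{id}}^{12}+8t_{\mathrm{id}}^8+12t_{\mathrm{id}}^6+8t_{\mathrm{id}}^4+6t_{\mathrm{id}}^{10}t_f^4\right).$$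
   Context: Tilings. Let $P$ be a polyhedron with set of faces $\mathcal F$ and let $\mathcal A$ be a group of isometries of $P$, acting on $\mathcal F$. A set of tile designs is a finite set $\mathcal T$ together with a group action of $\mathcal A$ on $\mathcal T\times\mathcal F$ lying over the action on $\mathcal F$ (so $A\cdot(T,F)=(T',A\cdot F)$ for some $T'\in\mathcal T$). A tiling is a map $\tau:\mathcal F\to\mathcal T$; $\mathcal A$ acts on tilings by moving graphs: $A\cdot\tau$ is the tiling with $((A\cdot\tau)(A\cdot F),A\cdot F)=A\cdot(\tau(F),F)$ for all $F$. The number of ways of tiling up to $\mathcal A$ is the number of $\mathcal A$-orbits on the set of tilings. The induced symmetry group $G$ of a face $F$ is the group of isometries of $F$ realized by elements of the stabilizer $\mathcal A_F$; for $g\in G$, $t_g$ is the number of $T\in\mathcal T$ with $g\cdot(T,F)=(T,F)$, where $g$ acts via the element of $\mathcal A_F$ inducing it. Since $\mathcal A$ acts transitively on faces, $t_g$ does not depend on the choice of $F$. In particular $t_{\mathrm{id}}=|\mathcal T|$. Polyhedra and group. Here $\mathcal A=O_h$ is the group of order $48$ of all $3\times3$ signed permutation matrices. The triakis octahedron (dual of the truncated cube) is the convex hull of the $O_h$-orbits of $(1,0,0)$ and $(\sqrt2-1)(1,1,1)$ ($6+8=14$ vertices, $24$ isosceles triangular faces). The deltoidal icositetrahedron (dual of the rhombicuboctahedron) is the convex hull of the $O_h$-orbits of $(1,0,0)$, $\frac{2\sqrt2+1}{7}(1,1,1)$ and $\frac{\sqrt2}{2}(1,1,0)$ ($6+8+12=26$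 vertices, $24$ kite-shaped faces). In both cases the induced symmetry group of a face is $\langle f\mid f^2=e\rangle$, with $f$ the reflection of the face in its axis of symmetry. *)

(* Defs.v *)
From HB Require Import structures.
From mathcomp Require Import all_boot all_order all_algebra all_fingroup.
From mathcomp Require Import mathcomp_extra boolp classical_sets cardinality.
From mathcomp Require Import reals convex.

Set Implicit Arguments.
Unset Strict Implicit.
Unset Printing Implicit Defensive.

Import Order.TTheory GRing.Theory Num.Theory.
Local Open Scope classical_set_scope.
Local Open Scope ring_scope.

(* Points of Euclidean space are column vectors, so that 3 x 3 matrices act on
   the left. *)

Section Geometry.
Context {R : realType}.

Definition dotv (u v : 'cV[R]_3) : R := (u^T *m v) 0 0.

Definition hull (S : set 'cV[R]_3) : set 'cV[R]_3 :=
  smallest [set C : set 'cV[R]_3 | convex_set C] S.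

Definition affine_hull (S : set 'cV[R]_3) : set 'cV[R]_3 :=
  [set x | exists n (w : 'I_n -> R) (v : 'I_n -> 'cV[R]_3),
    [/\ forall i, S (v i), \sum_i w i = 1 & x = \sum_i w i *: v i]].

(* Faces are the two-dimensional ones: the intersections of P with a supporting
   plane that contain three affinely independent points. *)
Definition faces (P : set 'cV[R]_3) : set (set 'cV[R]_3) :=
  [set F | (exists a b, [/\ a != 0, forall x, P x -> dotv a x <= b
                          & F = [set x | P x /\ dotv a x = b]]) /\
           (exists x y z, [/\ F x, F y, F z
                            & \rank (row_mx (y - x) (z - x)) = 2%N])].

(* The image A . S of a set of points. *)
Definition mximg (A : 'M[R]_3) (S : set 'cV[R]_3) : set 'cV[R]_3 :=
  [set A *m x | x in S].

(* A maps F to itself, and restricted to F it is the reflection in a line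
   (through p, directed by u) of the plane of F. *)
Definition reflects_face (F : set 'cV[R]_3) (A : 'M[R]_3) : Prop :=
  mximg A F = F /\
  exists p u, [/\ u != 0,
    forall c, affine_hull F (p + c *: u)
    & forall x, F x -> dotv (A *m x - x) u = 0 /\
                       exists c, 2^-1 *: (x + A *m x) = p + c *: u].

End Geometry.

Section Octahedral.
Variable R : realType.

(* The signed permutation matrices. *)
Definition Oh : set 'M[R]_3 :=
  [set A | exists (e : 'I_3 -> bool) (s : 'S_3),
             A = diag_mx (\row_i (-1) ^+ e i) *m perm_mx s].

Definition Oh_orbit (v : 'cV[R]_3) : set 'cV[R]_3 := [set A *m v | A in Oh].

Definition vec3 (x y z : R) : 'cV[R]_3 := \col_i nth 0 [:: x; y; z] i.

Definition triakis_octahedron : set 'cV[R]_3 :=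
  hull (Oh_orbit (vec3 1 0 0) `|`
        Oh_orbit ((Num.sqrt 2 - 1) *: vec3 1 1 1)).

Definition deltoidal_icositetrahedron : set 'cV[R]_3 :=
  hull (Oh_orbit (vec3 1 0 0) `|`
        Oh_orbit ((2 * Num.sqrt 2 + 1) / 7 *: vec3 1 1 1) `|`
        Oh_orbit (Num.sqrt 2 / 2 *: vec3 1 1 0)).

End Octahedral.

Arguments Oh : clear implicits.
Arguments triakis_octahedron : clear implicits.
Arguments deltoidal_icositetrahedron : clear implicits.

Section Tilings.
Context {R : realType}.

(* A finite set T of tile designs for P with symmetry group G: a left action
   of G on T x faces P lying over the action on faces. The values of
   design_act at matrices outside G are irrelevant. *)
Record tile_designs (G : set 'M[R]_3) (P : set 'cV[R]_3) (T : finType) := {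
  design_act : 'M[R]_3 -> T * faces P -> T * faces P;
  design_act1 : forall x, design_act 1%:M x = x;
  design_actM : forall A B x, G A -> G B ->
    design_act (A *m B) x = design_act A (design_act B x);
  design_act_over : forall A x, G A ->
    val (design_act A x).2 = mximg A (val x.2)
}.

Variables (G : set 'M[R]_3) (P : set 'cV[R]_3) (T : finType).
Variable D : tile_designs G P T.

(* The number t_g of designs fixed at the face F by the symmetry g of F that
   is induced by A. *)
Definition num_fixed (F : faces P) (A : 'M[R]_3) : nat :=
  #|[pred t : T | design_act D A (t, F) == (t, F)]|.

(* The tiling tau' is A . tau: the graph of tau' is the image of the graph of
   tau. *)
Definition moves (A : 'M[R]_3) (tau tau' : faces P -> T) : Prop :=
  forall F F' : faces P, val F' = mximg A (val F) ->
    (tau' F', F') = design_act D A (tau F, F).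

Definition tiling_orbit (tau : faces P -> T) : set (faces P -> T) :=
  [set tau' | exists2 A, G A & moves A tau tau'].

(* The set of orbits of tilings. *)
Definition tiling_orbits : set (set (faces P -> T)) := range tiling_orbit.

End Tilings.

(* Main.v *)
Require Import Defs.
From HB Require Import structures.
From mathcomp Require Import all_boot all_order all_algebra all_fingroup.
From mathcomp Require Import mathcomp_extra boolp classical_sets cardinality.
From mathcomp Require Import cyclic interval_inference reals convex.
From mathcomp Require Import ring lra.

Set Implicit Arguments.
Unset Strict Implicit.
Unset Printing Implicit Defensive.

Import Order.TTheory GRing.Theory Num.Theory.

(** The count is an application of Burnside's lemma (Frobenius_Cauchy), once the
    faces and the group have been replaced by finite combinatorial models.

    Geometry. Put y = sqrt 2 - 1, so that y * (y + 2) = 1. Both solids are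
    intersections of the 24 half-spaces n.p <= 1, where n runs through the
    vectors obtained from (alpha, beta, beta) by permuting coordinates and
    changing signs, with (alpha, beta) = (y, 1) for the triakis octahedron and
    (1, y) for the deltoidal icositetrahedron (triakis_octahedronE,
    deltoidal_icositetrahedronE). The vertices satisfy these inequalities.
    Conversely O_h moves every point into the chamber q_0 >= q_1 >= q_2 >= 0,
    the cone over the three directions (1,0,0), (1,1,0), (1,1,1); on a single
    facet plane each direction meets the hull, so a point of the chamber in the
    intersection of the half-spaces is a convex combination of 0 and these three
    points. A two-dimensional face of an intersection of finitely many
    half-spaces is cut out by one of their boundary planes (faces_polar), hence
    there are exactly 24 faces, indexed by an octant, which gives the signs of
    the normal, and an axis, which carries alpha.

    Combinatorics. An element (e, s) of O_h can fix the face (d, i) only if s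
    fixes i and e = d + d o s. So the stabilizer of a face has one nontrivial
    element, the diagonal reflection exchanging the two other axes up to signs
    (octcell_stab_unique). That element is unique and O_h is transitive on
    faces, so t_f does not depend on the face. An element none of whose
    nontrivial powers fixes a face permutes the 24 faces in cycles whose length
    is its order n, and a tiling that it fixes amounts to a free choice of one
    design per cycle: t_id ^ (24 / n) tilings. Each of the 6 diagonal
    reflections fixes 4 faces and exchanges the other 20 in pairs, hence fixes
    t_f ^ 4 * t_id ^ 10 tilings. Among the other elements 1, 13, 8, 12 and 8
    have order 1, 2, 3, 4 and 6 (sum_fixed_tilings). *)

(** * Tilings fixed by a group acting on cells and designs *)

Section Cocycle.
Local Open Scope group_scope.

Variables (gT : finGroupType) (X T : finType) (to : {action gT &-> X}).

(** An action on designs-with-cell lying over an action on cells: g sends the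
    design t at the cell x to the design c g x t at the cell x.g. Actions are
    on the right, as for all finite group actions here. *)
Record cocycle := Cocycle {
  cocycle_fun :> gT -> X -> T -> T;
  cocycle1 : forall x t, cocycle_fun 1 x t = t;
  cocycleM : forall g h x t,
    cocycle_fun (g * h) x t = cocycle_fun h (to x g) (cocycle_fun g x t) }.

Variable c : cocycle.
Implicit Types (g h : gT) (H : {group gT}) (x y : X) (t : T).
Implicit Types tau : {ffun X -> T}.

Lemma cocycleK g x : cancel (c g x) (c g^-1 (to x g)).
Proof. by move=> t; rewrite -cocycleM mulgV cocycle1. Qed.

Lemma cocycleKV g x : cancel (c g^-1 (to x g)) (c g x).
Proof.
by move=> t; have := cocycleK g^-1 (to x g) t; rewrite actK invgK.
Qed.

Definition tiling_act tau g : {ffun X -> T} :=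
  [ffun x => c g (to x g^-1) (tau (to x g^-1))].

Lemma tiling_act1 : tiling_act^~ 1 =1 id.
Proof. by move=> tau; apply/ffunP => x; rewrite ffunE invg1 act1 cocycle1. Qed.

Lemma tiling_actM tau : act_morph tiling_act tau.
Proof.
by move=> g h; apply/ffunP => x; rewrite !ffunE cocycleM invMg actM actKV.
Qed.

Definition tiling_action := TotalAction tiling_act1 tiling_actM.

Lemma tiling_actP tau tau' g :
  reflect (forall x, tau' (to x g) = c g x (tau x)) (tau' == tiling_action tau g).
Proof.
apply: (iffP eqP) => [-> x | tau'E]; first by rewrite ffunE actK.
by apply/ffunP => x; rewrite ffunE -tau'E actKV.
Qed.

Definition fixed_designs H x : pred T :=
  [pred t | [forall h in 'C_H[x | to], c h x t == t]].

Lemma fixed_designsP H x t :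
  reflect (forall h, h \in H -> to x h = x -> c h x t = t)
          (t \in fixed_designs H x).
Proof.
apply: (iffP 'forall_in_eqP) => fix_t h.
  by move=> Hh xh; apply: fix_t; rewrite inE Hh; apply/astab1P.
by rewrite inE => /andP[Hh /astab1P]; apply: fix_t.
Qed.

(** A fixed tiling is determined by its values on one cell per orbit, since the
    value at x.h is forced by the value at x. The value at a representative x
    is subject to the only condition that the stabilizer of x fixes it. *)
Theorem card_fixed_tilings H :
  #|'Fix_tiling_action(H)| =
    (\prod_(x in orbit_transversal to H [set: X]%SET) #|fixed_designs H x|)%N.
Proof.
set X0 := orbit_transversal to H [set: X]%SET.
have actsH : [acts H, on [set: X]%SET | to].
  by apply/actsP => a _ x; rewrite !finset.in_setT.
have [_ _] := orbit_transversalP actsH; rewrite -/X0 => X0P X0ex.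
have /fin_all_exists[a aP] x : exists a, a \in H /\ to x a \in X0.
  by have [//|a] := X0ex x; exists a.
have Ha x : a x \in H by case: (aP x).
pose r x : {x | x \in X0} := Sub (to x (a x)) (proj2 (aP x)).
have rJ x h : h \in H -> r (to x h) = r x.
  move=> Hh; apply/val_inj/esym/eqP; rewrite -X0P ?(valP (r _)) //=.
  apply/orbitP; exists ((a x)^-1 * h * a (to x h)); first by rewrite !groupM ?groupV.
  by rewrite !actM actK.
have rX0 (k : {x | x \in X0}) : r (val k) = k.
  apply/val_inj/esym/eqP; rewrite -X0P ?(valP k) ?(valP (r _)) //.
  by apply/orbitP; exists (a (val k)).
pose ext (rho : {ffun {x | x \in X0} -> T}) : {ffun X -> T} :=
  [ffun x => c (a x)^-1 (val (r x)) (rho (r x))].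
pose fam := family (fun k : {x | x \in X0} => fixed_designs H (val k)).
have extX0 rho k : rho \in fam -> ext rho (val k) = rho k.
  move=> /familyP/(_ k)/fixed_designsP fixk; rewrite ffunE rX0 fixk ?groupV //.
  by rewrite -{1}(rX0 k) actK.
transitivity #|fam|; last first.
  by rewrite card_family foldrE big_image /= [RHS]big_sub.
(* Conversely, restricting a fixed tiling to the representatives inverts [ext]. *)
have ext_inj : {in fam &, injective ext}.
  move=> rho1 rho2 fam1 fam2 e; apply/ffunP => k.
  by rewrite -(extX0 rho1) // e extX0.
rewrite -(card_in_imset ext_inj); apply: eq_card => tau.
apply/idP/imsetP => [/afixP fix_tau | [rho rhoF ->]].
  have tauJ h x : h \in H -> tau (to x h) = c h x (tau x).
    by move=> Hh; apply/tiling_actP; rewrite fix_tau.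
  exists [ffun k => tau (val k)].
    by apply/familyP => k; apply/fixed_designsP => h Hh kh; rewrite ffunE -tauJ ?kh.
  by apply/ffunP => x; rewrite !ffunE -tauJ ?groupV // actK.
apply/afixP => h Hh; apply/esym/eqP/tiling_actP => x.
(* The elements (a x)^-1 * h and (a (x.h))^-1 both take the representative k to
   x.h, so they differ by an element of its stabilizer. *)
rewrite !ffunE rJ //; set k := r x; pose v := a (to x h).
have kE : to (val k) (a x)^-1 = x by rewrite actK.
have kv : to (val k) ((a x)^-1 * h * v) = val k.
  by rewrite !actM kE -[RHS](congr1 val (rJ x h Hh)).
move/familyP/(_ k)/fixed_designsP/(_ ((a x)^-1 * h * v)): rhoF => rhoF.
rewrite -[in c h x]kE -cocycleM -[in RHS](mulgK v ((a x)^-1 * h)).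
by rewrite cocycleM kv rhoF // !groupM ?groupV // Ha.
Qed.

Lemma sum_card_orbit_transversal H :
  (\sum_(x in orbit_transversal to H [set: X]%SET) #|orbit to H x| = #|X|)%N.
Proof.
have actsH : [acts H, on [set: X]%SET | to].
  by apply/actsP => a _ x; rewrite !finset.in_setT.
have [_ _] := orbit_transversalP actsH.
set X0 := orbit_transversal _ _ _ => X0P X0ex.
rewrite -[RHS]cardsT -(acts_sum_card_orbit actsH).
have -> : orbit to H @: [set: X]%SET = orbit to H @: X0.
  apply/setP => O; apply/imsetP/imsetP => -[x x_in ->]; last by exists x.
  have [a Ha x0] := X0ex x x_in; exists (to x a) => //.
  exact/esym/orbit_act.
rewrite [RHS]big_imset //= => x y X0x X0y /orbit_eqP; rewrite orbit_sym X0P //.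
by move/eqP.
Qed.

Theorem card_fixed_tilings_free H :
    (forall x h, h \in H -> to x h = x -> h = 1) ->
  #|'Fix_tiling_action(H)| = (#|T| ^ (#|X| %/ #|H|))%N.
Proof.
move=> freeH; rewrite card_fixed_tilings -(sum_card_orbit_transversal H).
rewrite [in RHS](eq_bigr (fun=> #|H|)) => [|x _]; last first.
  rewrite card_orbit (_ : 'C_H[x | to] = 1) ?indexg1 //.
  apply/trivgP/fintype.subsetP => h /setIP[Hh /astab1P xh].
  by rewrite (freeH x h) ?inE.
rewrite sum_nat_const mulnK ?cardG_gt0 // -prod_nat_const.
apply: eq_bigr => x _; apply: eq_card => t; rewrite inE.
by apply/fixed_designsP => h Hh xh; rewrite (freeH x h) ?cocycle1.
Qed.

(** If g ^+ k fixes x then so does g ^+ d for d = gcd (n, k). Were d a proper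
    divisor of n, it would divide n / p for some prime p, and g ^+ (n / p) would
    fix x. So freeness is tested on maximal proper divisors only. The cell x0
    is there because on no cells at all the order of g could be any divisor of
    n. *)
Lemma free_cycle g n (x0 : X) :
    0 < n -> g ^+ n = 1 ->
    (forall p x, p \in primes n -> to x (g ^+ (n %/ p)) <> x) ->
  (forall x h, h \in <[g]> -> to x h = x -> h = 1) /\ #[g] = n.
Proof.
move=> n_gt0 gn1 moved.
have dvdn_fix x k : to x (g ^+ k) = x -> n %| k.
  have [->|k_gt0] := posnP k; first by rewrite dvdn0.
  move=> xk; apply: contraT => n_ndvd; have [u v uv _] := egcdnP n k_gt0.
  have xd : to x (g ^+ gcdn n k) = x.
    have xM m y : to y (g ^+ m) = y -> forall j, to y (g ^+ (m * j)) = y.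
      move=> ym; elim=> [|j IHj]; first by rewrite muln0 act1.
      by rewrite mulnS expgD actM ym.
    have := xM k x xk u; rewrite mulnC uv mulnC expgD actM.
    by rewrite expgM gn1 expg1n act1 gcdnC.
  have d_dvd := dvdn_gcdl n k; have d_gt0 : 0 < gcdn n k by rewrite gcdn_gt0 n_gt0.
  have q_gt1 : 1 < n %/ gcdn n k.
    rewrite ltn_divRL // mul1n ltn_neqAle dvdn_leq // andbT.
    by apply: contra n_ndvd => /eqP <-; apply: dvdn_gcdr.
  have [p p_pr /dvdnP[m qE]] := pdivP q_gt1.
  have nE : n = (m * gcdn n k * p)%N by rewrite mulnAC -qE divnK.
  case: (moved p x); first by rewrite mem_primes p_pr n_gt0 nE dvdn_mull.
  rewrite {1}nE mulnK ?prime_gt0 // mulnC.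
  elim: (m) => [|j IHj]; first by rewrite muln0 act1.
  by rewrite mulnS expgD actM xd.
split=> [x h /cycleP[k ->] /dvdn_fix/dvdnP[m ->]|].
  by rewrite mulnC expgM gn1 expg1n.
apply/eqP; rewrite eqn_dvd; apply/andP; split; last first.
  by apply: (dvdn_fix x0); rewrite expg_order act1.
by rewrite order_dvdn gn1.
Qed.

Corollary card_fixed_tilings_order g n (x0 : X) :
    0 < n -> g ^+ n = 1 ->
    (forall p x, p \in primes n -> to x (g ^+ (n %/ p)) <> x) ->
  #|'Fix_tiling_action[g]| = (#|T| ^ (#|X| %/ n))%N.
Proof.
move=> n_gt0 gn1 moved; have [freeg <-] := free_cycle x0 n_gt0 gn1 moved.
by rewrite -afix_cycle card_fixed_tilings_free.
Qed.

(** The orbits of an involution r are fixed cells, each with f admissible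
    designs, and pairs, where the design at one cell determines the other. *)
Theorem card_fixed_tilings_involution r f :
    r ^+ 2 = 1 -> (forall x, to x r = x -> #|[pred t | c r x t == t]| = f) ->
  #|'Fix_tiling_action[r]| =
    (#|T| ^ ((#|X| - #|'Fix_to[r]|)./2) * f ^ #|'Fix_to[r]|)%N.
Proof.
move=> r2 fixf; have HE h : h \in <[r]> -> h = 1 \/ h = r.
  case/cycleP=> k ->; rewrite -(odd_double_half k) expgD -mul2n expgM r2.
  by rewrite expg1n mulg1; case: odd; [right | left].
have Hr : r \in <[r]> := cycle_id r.
have HfixP x : reflect (to x r = x) (x \in 'Fix_to[r]) := afix1P.
rewrite -afix_cycle card_fixed_tilings.
have := sum_card_orbit_transversal <[r]>.
have actsH : [acts <[r]>, on [set: X]%SET | to].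
  by apply/actsP => a _ x; rewrite !finset.in_setT.
have [_ _ _] := orbit_transversalP actsH.
set X0 := orbit_transversal _ _ _ => X0ex.
have fixX0 : 'Fix_to[r] \subset X0.
  apply/fintype.subsetP => x; rewrite -afix_cycle => /afixP xfix.
  by have [a Ha] := X0ex x (finset.in_setT x); rewrite xfix.
rewrite (big_setID 'Fix_to[r]) [in X in _ -> X](big_setID 'Fix_to[r]) /=.
rewrite (finset.setIidPr fixX0).
rewrite (eq_bigr (fun=> 1%N)) => [|x /HfixP xr]; last first.
  apply/eqP/cards1P; exists x; apply/setP => y; rewrite inE.
  apply/orbitP/eqP => [[h /HE[]-> <-] //|->]; first exact: act1.
  by exists 1; rewrite ?group1 ?act1.
rewrite sum1_card (eq_bigr (fun=> 2%N)) => [|x /setDP[_ /HfixP xr]]; last first.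
  rewrite (_ : orbit _ _ _ = [set x; to x r]%SET) ?cards2.
    by rewrite eq_sym; case: eqP.
  apply/setP => y; rewrite !inE.
  apply/orbitP/orP => [[h /HE[]-> <-]|[]/eqP->]; rewrite ?act1.
  - by left.
  - by right.
  - by exists 1; rewrite ?group1 ?act1.
  - by exists r.
rewrite sum_nat_const => <-; rewrite addKn muln2 doubleK mulnC.
congr (_ * _)%N; rewrite -prod_nat_const; apply: eq_bigr => x.
  case/setDP=> _ /HfixP xr; apply: eq_card => t; rewrite inE.
  by apply/fixed_designsP => h /HE[]->; rewrite ?cocycle1.
move=> /HfixP xr; rewrite -(fixf x xr); apply: eq_card => t.
rewrite inE; apply/fixed_designsP/eqP => [->//|xt h /HE[]-> _ //].
exact: cocycle1.
Qed.

(** Transport by h carries the designs at x fixed by g to the designs at x.h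
    fixed by the conjugate of g. *)
Lemma card_fixed_designs_conj g h x :
    to x g = x ->
  #|[pred t | c g x t == t]| =
  #|[pred t | c (g ^ h) (to x h) t == t]|.
Proof.
move=> xg; rewrite -(fintype.card_image (can_inj (cocycleK h x))).
apply: eq_card => t; rewrite inE; apply/fintype.imageP/eqP => [[u /eqP gu ->]|gt].
  by rewrite -cocycleM -conjgC cocycleM xg gu.
exists (c h^-1 (to x h) t); last by rewrite cocycleKV.
rewrite inE; apply/eqP/(can_inj (cocycleK h x)).
by rewrite -[in c h x]xg -cocycleM conjgC cocycleM xg cocycleKV gt.
Qed.
End Cocycle.
(** * The octahedral group and its action on octant-axis pairs *)

Section OctahedralGroup.

(** The pair (e, s) stands for the signed permutation matrix that sends v to
    the vector of coordinates (-1) ^+ e i * v (s i). *)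
Definition octa : Type := {ffun 'I_3 -> bool} * 'S_3.

HB.instance Definition _ := Finite.copy octa ({ffun 'I_3 -> bool} * 'S_3)%type.

Implicit Types g h : octa.

(** The product g * h stands for the matrix product M h *m M g: in this order
    the left action of matrices becomes a right action of octa. *)
Definition octa_mul g h : octa :=
  ([ffun i => h.1 i (+) g.1 (h.2 i)], h.2 * g.2)%g.
Definition octa_one : octa := ([ffun=> false], 1%g).
Definition octa_inv g : octa := ([ffun i => g.1 (g.2^-1 i)%g], g.2^-1)%g.

Lemma octa_mulA : associative octa_mul.
Proof.
move=> g h k; congr pair; last by rewrite /= mulgA.
by apply/ffunP => i; rewrite !ffunE permM addbA.
Qed.

Lemma octa_mul1 : left_id octa_one octa_mul.
Proof.
move=> [e s]; congr pair; last by rewrite /= mulg1.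
by apply/ffunP => i; rewrite !ffunE addbF.
Qed.

Lemma octa_mulV : left_inverse octa_one octa_inv octa_mul.
Proof.
move=> [e s]; congr pair; last by rewrite /= mulgV.
by apply/ffunP => i; rewrite !ffunE permK addbb.
Qed.

HB.instance Definition _ :=
  Finite_isGroup.Build octa octa_mulA octa_mul1 octa_mulV.

Lemma octaE1 g h i : (g * h)%g.1 i = h.1 i (+) g.1 (h.2 i).
Proof. by rewrite ffunE. Qed.

Lemma octaE2 g h : (g * h)%g.2 = (h.2 * g.2)%g.
Proof. by []. Qed.

(** The cell (d, i) stands for the face whose normal has the signs d and a
    distinguished i-th coordinate. *)
Definition octcell : Type := {ffun 'I_3 -> bool} * 'I_3.

HB.instance Definition _ := Finite.copy octcell ({ffun 'I_3 -> bool} * 'I_3)%type.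

Implicit Type x : octcell.

Definition octcell_act x g : octcell :=
  ([ffun j => g.1 j (+) x.1 (g.2 j)], (g.2^-1)%g x.2).

Lemma octcell_act1 : octcell_act^~ 1%g =1 id.
Proof.
move=> [d i]; congr pair; last by rewrite /= invg1 perm1.
by apply/ffunP => j; rewrite !ffunE perm1.
Qed.

Lemma octcell_actM x : act_morph octcell_act x.
Proof.
move=> g h; congr pair; last by rewrite /= invMg permM.
by apply/ffunP => j; rewrite !ffunE permM addbA.
Qed.

Definition octcell_action := TotalAction octcell_act1 octcell_actM.

Lemma card_octcell : #|{: octcell}| = 24%N.
Proof. by rewrite card_prod card_ffun card_bool !card_ord. Qed.

Lemma sum_octcell (F : octcell -> nat) :
  (\sum_x F x = \sum_(d : {ffun 'I_3 -> bool}) \sum_(i < 3) F (d, i))%N.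
Proof. by rewrite pair_bigA; apply: eq_bigr => -[]. Qed.

Lemma sum_octa (F : octa -> nat) :
  (\sum_g F g =
   \sum_(s : 'S_3) \sum_(e : {ffun 'I_3 -> bool}) F (e, s))%N.
Proof. by rewrite exchange_big pair_bigA; apply: eq_bigr => -[]. Qed.

(** The condition that a face is fixed, solved for g: given the cell and the
    permutation, the signs of g are forced. *)
Lemma octcell_fixP x g :
  octcell_action x g = x <-> g.2 x.2 = x.2 /\ forall j, g.1 j = x.1 j (+) x.1 (g.2 j).
Proof.
case: x => d i; split=> [[/ffunP dE iE]|[/= iE dE]].
  split=> [|j]; first by rewrite /= -{1}iE permKV.
  by have /= := dE j; rewrite ffunE => <-; rewrite -addbA addbb addbF.
congr pair; last by apply: (canLR (permK _)); rewrite iE.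
by apply/ffunP => j; rewrite ffunE dE -addbA addbb addbF.
Qed.

End OctahedralGroup.

(** * Permutations of three axes as affine maps of Z/3 *)

Section SymmetricGroup3.
Local Open Scope ring_scope.

(** Indices are computed in Z/3; the last one is written 1 + 1. *)
Lemma ord3_ind (P : 'I_3 -> Prop) : P 0 -> P 1 -> P (1 + 1) -> forall i, P i.
Proof.
by move=> P0 P1 P2 [[|[|[|//]]] lti]; [move: P0|move: P1|move: P2];
  congr P; apply: val_inj.
Qed.

(** S_3 is the affine group of Z/3: translations by nonzero constants are the
    3-cycles, and i |-> c - i is the transposition with fixed point c + c. *)
Definition affine3 (b : bool) (c i : 'I_3) : 'I_3 := if b then c - i else c + i.

Lemma affine3_inj b c : injective (affine3 b c).
Proof. by case: b => i j /addrI // /oppr_inj. Qed.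

Definition affine_perm b c : 'S_3 := perm (@affine3_inj b c).

Lemma affine_perm_bij : bijective (fun bc => affine_perm bc.1 bc.2).
Proof.
apply: inj_card_bij => [[b c] [b' c'] /= /permP e|]; last first.
  by rewrite card_prod card_bool card_ord card_Sn.
have := e 0; have := e 1; rewrite !permE /affine3 {e}.
by elim/ord3_ind: c; elim/ord3_ind: c'; case: b; case: b'.
Qed.

Lemma ord3_cases (i j : 'I_3) : [\/ j = i, j = i + 1 | j = i - 1].
Proof.
by elim/ord3_ind: i; elim/ord3_ind: j;
  solve [exact/Or31/val_inj | exact/Or32/val_inj | exact/Or33/val_inj].
Qed.

Lemma ord3_neighbours_neq (i : 'I_3) : i + 1 <> i - 1.
Proof. by elim/ord3_ind: i. Qed.

Lemma sum_affine_perm (F : 'S_3 -> nat) :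
  (\sum_s F s = \sum_b \sum_c F (affine_perm b c))%N.
Proof.
rewrite pair_big /= (reindex (fun bc => affine_perm bc.1 bc.2)) //.
exact/onW_bij/affine_perm_bij.
Qed.

(** The base point i is arbitrary because the number of tilings fixed by an
    element above a transposition depends on the signs through their position
    relative to the fixed axis. *)
Lemma sum_bool3 (i : 'I_3) (F : bool -> bool -> bool -> nat) :
  (\sum_(e : {ffun 'I_3 -> bool}) F (e i) (e (i + 1)%R) (e (i - 1)%R) =
   \sum_a \sum_b \sum_c F a b c)%N.
Proof.
pose mk (p : bool * bool * bool) : {ffun 'I_3 -> bool} :=
  [ffun j => if j == i then p.1.1 else if j == i + 1 then p.1.2 else p.2].
have mkE p : [/\ mk p i = p.1.1, mk p (i + 1) = p.1.2 & mk p (i - 1) = p.2].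
  by rewrite !ffunE eqxx; elim/ord3_ind: i {mk}.
have mk_bij : bijective mk.
  apply: inj_card_bij => [p q pq|]; last first.
    by rewrite card_ffun !card_prod card_bool card_ord.
  have [p1 p2 p3] := mkE p; have [q1 q2 q3] := mkE q.
  case: p q pq p1 p2 p3 q1 q2 q3 => [[a b] c] [[a' b'] c'] -> /=.
  by move=> -> -> -> -> -> ->.
rewrite !pair_big /= (reindex mk); last exact: onW_bij.
by apply: eq_bigr => p _; have [-> -> ->] := mkE p.
Qed.

Lemma affine_perm1 : affine_perm false 0 = 1%g.
Proof. by apply/permP => i; rewrite !permE /affine3 add0r. Qed.

Lemma rotation_perm_moves c i : c != 0 -> affine_perm false c i <> i.
Proof.
by move=> c0; rewrite permE /affine3 -[X in _ = X]add0r => /addIr/eqP; apply/negP.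
Qed.

Lemma rotation_permM c c' :
  (affine_perm false c * affine_perm false c')%g = affine_perm false (c + c').
Proof. by apply/permP => i; rewrite permM !permE /affine3 addrA (addrC c). Qed.

Lemma reflection_permM c : (affine_perm true c * affine_perm true c)%g = 1%g.
Proof. by apply/permP => i; rewrite permM !permE /affine3 subKr. Qed.

Lemma reflection_permE i :
  [/\ affine_perm true (i + i) i = i,
      affine_perm true (i + i) (i + 1) = i - 1 &
      affine_perm true (i + i) (i - 1) = i + 1].
Proof. by rewrite !permE /affine3; elim/ord3_ind: i; split; apply: val_inj. Qed.

(** The only nontrivial permutation fixing i exchanges i + 1 and i - 1: it is
    j |-> 2 i - j. *)
Lemma perm3_fix (s : 'S_3) i :
  s i = i -> s != 1%g -> s = affine_perm true (i + i).
Proof.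
have [r _ rK] := affine_perm_bij; rewrite -(rK s) /=; case: (r s) => b c /=.
case: b => /=; rewrite permE /affine3; first by move=> {1}<-; rewrite subrK.
rewrite -[X in _ = X]add0r => /addIr ->.
by rewrite affine_perm1 eqxx.
Qed.

End SymmetricGroup3.

(** * The Burnside sum of the octahedral group *)

Section OctahedralCount.
Local Open Scope ring_scope.

Lemma octa_eq1 (e : {ffun 'I_3 -> bool}) (s : 'S_3) :
  reflect (s = 1%g /\ forall j, e j = false) ((e, s) == 1%g :> octa).
Proof.
apply: (iffP eqP) => [[-> ->]|[-> e0]]; first by split=> // j; rewrite ffunE.
by congr pair; apply/ffunP => j; rewrite e0 ffunE.
Qed.

Lemma octcell_fix_perm1 (g : octa) x :
  octcell_action x g = x -> g.2 = 1%g -> g = 1%g.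
Proof.
case/octcell_fixP=> _; case: g => e s /= eE s1; rewrite s1 in eE *.
by apply/eqP/octa_eq1; split=> // j; rewrite eE perm1 addbb.
Qed.

(** A nontrivial element fixing (d, i) has a nontrivial permutation fixing i,
    which is the transposition of the two other axes, and its signs are then
    forced by d. *)
Lemma octcell_stab_unique x g h :
    octcell_action x g = x -> g != 1%g ->
    octcell_action x h = x -> h != 1%g -> g = h.
Proof.
have sE k : octcell_action x k = x -> k != 1%g ->
    k.2 = affine_perm true (x.2 + x.2).
  move=> xk k1; apply: perm3_fix; first by have /octcell_fixP[] := xk.
  by apply: contra k1 => /eqP/(octcell_fix_perm1 xk) ->.
move=> xg g1 xh h1; have sgh : g.2 = h.2 by rewrite sE // sE.
case/octcell_fixP: xg => _ gE; case/octcell_fixP: xh => _ hE.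
case: g h sgh gE hE {g1 h1} => e s [e' s'] /= -> eE e'E.
by congr pair; apply/ffunP => j; rewrite eE e'E.
Qed.

Lemma octcell_trans x y : exists g, octcell_action x g = y.
Proof.
case: x y => d i [d' i'].
pose s := affine_perm false (i - i').
exists ([ffun j => d' j (+) d (s j)], s); congr pair.
  by apply/ffunP => j; rewrite !ffunE -addbA addbb addbF.
by apply: (canLR (permK _)); rewrite permE /affine3 subrK.
Qed.

Variables (T : finType) (c : cocycle T octcell_action) (f : nat).
Hypothesis fixf : forall x (g : octa), g != 1%g -> octcell_action x g = x ->
  #|[pred t | c g x t == t]| = f.

Let t := #|T|.
Let act_c := tiling_action c.
Let fixed (g : octa) := #|'Fix_act_c[g]%g|.
Let x0 : octcell := ([ffun=> false], 0).

Let fixed_order g n : (0 < n)%N -> (g ^+ n)%g = 1%g ->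
    (forall p x, p \in primes n ->
       octcell_action x (g ^+ (n %/ p))%g <> x) ->
  fixed g = (t ^ (24 %/ n))%N.
Proof. by rewrite -card_octcell; apply: (card_fixed_tilings_order c x0). Qed.

Let fixed_order2 g : (g * g)%g = 1%g -> (forall x, octcell_action x g <> x) ->
  fixed g = (t ^ 12)%N.
Proof.
move=> g2 gx; rewrite (@fixed_order g 2) ?expg2 // => p x.
by rewrite inE => /eqP ->; rewrite expg1.
Qed.

(** A nontrivial change of signs has order 2 and moves every face, as it moves
    every octant. *)
Lemma fixed_tilings_signs (e : {ffun 'I_3 -> bool}) :
  fixed (e, 1%g) = if [|| e 0, e 1 | e (- 1)] then (t ^ 12)%N else (t ^ 24)%N.
Proof.
case: ifP => e0; last first.
  suff -> : (e, 1%g) = 1%g :> octa.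
    by rewrite (@fixed_order 1%g 1) ?divn1.
  have [e1 e2 e3] : [/\ ~~ e 0, ~~ e 1 & ~~ e (- 1)].
    by move/negbT: e0; rewrite !negb_or => /and3P.
  apply/eqP/octa_eq1; split=> // j; apply/negbTE.
  by elim/ord3_ind: j; rewrite // (_ : 1 + 1 = - 1 :> 'I_3) //; apply: val_inj.
apply: fixed_order2 => [|x].
  by apply/eqP/octa_eq1; split=> [|j]; rewrite ?ffunE ?perm1 ?addbb ?mulg1.
move/octcell_fix_perm1 => /(_ erefl)/eqP/octa_eq1[_ eE].
by rewrite !eE in e0.
Qed.

(** If s is a 3-cycle, then g and g ^+ 2 move every axis, and g ^+ 3 is 1 or -1
    according to the product of the signs: g has order 3 or 6. *)
Lemma fixed_tilings_rotation (e : {ffun 'I_3 -> bool}) i : i != 0 ->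
  fixed (e, affine_perm false i) =
  if e 0 (+) e 1 (+) e (- 1) then (t ^ 4)%N else (t ^ 8)%N.
Proof.
move=> i0; set g : octa := (e, _).
have gx x : octcell_action x g <> x.
  by case/octcell_fixP => /rotation_perm_moves-/(_ i0).
have ggx x : octcell_action x (g * g)%g <> x.
  case/octcell_fixP; rewrite octaE2 rotation_permM.
  by move/rotation_perm_moves; case; elim/ord3_ind: i i0 {g gx}.
have g3E : (g * (g * g))%g = ([ffun => e 0 (+) e 1 (+) e (- 1)], 1%g) :> octa.
  congr pair; last first.
    rewrite !octaE2 !rotation_permM -affine_perm1; congr affine_perm.
    by elim/ord3_ind: i i0 {g gx ggx} => // _; apply: val_inj.
  have eE k : e k = if k == 0 then e 0 else if k == 1 then e 1 else e (- 1).
    by elim/ord3_ind: k => //=; congr (e _); apply: val_inj.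
  apply/ffunP => j; rewrite !ffunE /= permM !permE /affine3.
  rewrite (eE j) (eE (i + j)) (eE (i + (i + j))).
  by elim/ord3_ind: i i0 {g gx ggx} => // _; elim/ord3_ind: j => /=;
    case: (e 0) (e 1) (e (- 1)) => [] [] [].
have g3x (b : bool) x : b -> octcell_action x ([ffun=> b], 1%g) <> x.
  by move=> b1 /octcell_fix_perm1/(_ erefl)/eqP/octa_eq1[_ /(_ 0)]; rewrite ffunE b1.
case: ifP g3E => [e1|_] g3E.
  apply: (@fixed_order g 6) => [//||p x].
    rewrite (expgM g 3 2) expg2 expgS expg2 g3E.
    by apply/eqP/octa_eq1; split=> [|k]; rewrite ?ffunE ?mulg1.
  rewrite !inE => /orP[] /eqP->; first by rewrite expgS expg2 g3E; apply: g3x.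
  by rewrite expg2.
apply: (@fixed_order g 3) => [//||p x].
  by rewrite expgS expg2 g3E; apply/eqP/octa_eq1; split=> // k; rewrite ffunE.
by rewrite inE => /eqP->; rewrite expg1.
Qed.

(** Let s exchange the axes i + 1 and i - 1. If their signs differ, g ^+ 2 is a
    nontrivial sign change and g has order 4 (quarter turns and improper ones).
    If they agree, g is an involution: a half-turn when the sign of i is
    negative, which moves every face, and a diagonal reflection otherwise,
    which fixes the faces on axis i in the 4 octants that it preserves. *)
Lemma fixed_tilings_reflection (e : {ffun 'I_3 -> bool}) i :
  fixed (e, affine_perm true (i + i)) =
  if e (i + 1) (+) e (i - 1) then (t ^ 6)%N
  else if e i then (t ^ 12)%N else (t ^ 10 * f ^ 4)%N.
Proof.
have [si sj sk] := reflection_permE i.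
set s := affine_perm _ _ in si sj sk *; set g : octa := (e, s).
have s2 : (s * s)%g = 1%g by apply: reflection_permM.
have g2E : (g * g)%g = ([ffun j => e j (+) e (s j)], 1%g) :> octa.
  by congr pair; apply: s2.
case: ifP => [ejk|/negbT]; last rewrite negb_add => /eqP ejk.
  apply: (@fixed_order g 4) => [//||p x].
    rewrite (expgM g 2 2) !expg2 g2E; apply/eqP/octa_eq1; split=> [|j].
      by rewrite mulg1.
    by rewrite !ffunE perm1 addbb.
  rewrite inE => /eqP->; rewrite expg2 g2E => /octcell_fix_perm1/(_ erefl).
  by move/eqP/octa_eq1 => [_ /(_ (i + 1))]; rewrite ffunE sj ejk.
have g2 : (g * g)%g = 1%g.
  rewrite g2E; apply/eqP/octa_eq1; split=> // j; rewrite ffunE.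
  by have [->|->|->] := ord3_cases i j; rewrite ?si ?sj ?sk ?ejk addbb.
have gxE (x : octcell) :
  reflect (x.2 = i /\ x.1 (i + 1) (+) x.1 (i - 1) = e (i + 1) /\ ~~ e i)
                     (x \in 'Fix_octcell_action[g]%g).
  apply: (iffP afix1P) => [/octcell_fixP[/= sx eE]|[xi [xjk ei]]].
    have xi : x.2 = i.
      have [->//|xE|xE] := ord3_cases i x.2; move: sx; rewrite xE ?sj ?sk => sx;
        by case: (@ord3_neighbours_neq i).
    by split=> //; rewrite [e i]eE si addbb [e _]eE sj.
  apply/octcell_fixP; split; first by rewrite xi.
  move=> j; rewrite /=; have [->|->|->] := ord3_cases i j.
  - by rewrite si addbb; apply: negbTE.
  - by rewrite sj.
  - by rewrite sk -ejk -xjk addbC.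
have -> : fixed g = (t ^ ((24 - #|'Fix_octcell_action[g]%g|)./2) *
                     f ^ #|'Fix_octcell_action[g]%g|)%N.
  rewrite -card_octcell; apply: card_fixed_tilings_involution.
    by rewrite expg2.
  move=> x; apply: fixf.
  apply/negP => /octa_eq1[s1 _]; move: sj; rewrite s1 perm1.
  exact: ord3_neighbours_neq.
have -> : #|'Fix_octcell_action[g]%g| = if e i then 0%N else 4; last first.
  by case: ifP => _; rewrite ?muln1.
case: ifP => ei.
  by apply: eq_card0 => x; apply/negP => /gxE[_ []]; rewrite ei.
(* The fixed cells are (d, i) with d (i + 1) + d (i - 1) = e (i + 1), counted
   as a sum over d. *)
have -> : 4 = (\sum_(a : bool) \sum_b \sum_c (b (+) c == e (i + 1)%R))%N.
  by rewrite !big_bool /=; case: (e _).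
rewrite -(sum_bool3 i (fun a b c => (b (+) c == e (i + 1)) : nat)).
rewrite -sum1_card big_mkcond sum_octcell.
apply: eq_bigr => d _; rewrite (bigD1 i) //= big1 => [|k /eqP ki].
  rewrite addn0; case: gxE => [[_ [/= -> _]]|]; first by rewrite eqxx.
  by case: eqP => // dE []; rewrite ei.
by case: gxE => // -[].
Qed.

Theorem sum_fixed_tilings :
  (\sum_g fixed g = t ^ 24 + 13 * t ^ 12 + 8 * t ^ 8 + 12 * t ^ 6 + 8 * t ^ 4
                     + 6 * t ^ 10 * f ^ 4)%N.
Proof.
have reflections k : (\sum_e fixed (e, affine_perm true k) =
    2 * (t ^ 10 * f ^ 4) + 2 * t ^ 12 + 4 * t ^ 6)%N.
  have -> : k = k + k + (k + k) by elim/ord3_ind: k; apply: val_inj.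
  under eq_bigr do rewrite fixed_tilings_reflection.
  have -> := sum_bool3 (k + k) (fun a b c => if b (+) c then t ^ 6 else
    if a then t ^ 12 else t ^ 10 * f ^ 4)%N.
  by rewrite !big_bool /=; ring.
have rotations k : k != 0 ->
    (\sum_e fixed (e, affine_perm false k) = 4 * t ^ 8 + 4 * t ^ 4)%N.
  move=> k0; under eq_bigr do rewrite fixed_tilings_rotation //.
  have := sum_bool3 0 (fun a b c => if a (+) b (+) c then t ^ 4 else t ^ 8)%N.
  by rewrite add0r sub0r !big_bool /= => ->; ring.
have signs : (\sum_e fixed (e, 1%g) = t ^ 24 + 7 * t ^ 12)%N.
  under eq_bigr do rewrite fixed_tilings_signs.
  have := sum_bool3 0 (fun a b c => if [|| a, b | c] then t ^ 12 else t ^ 24)%N.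
  by rewrite add0r sub0r !big_bool /= => ->; ring.
rewrite sum_octa sum_affine_perm big_bool /=.
under eq_bigr do rewrite reflections.
rewrite sum_nat_const card_ord (bigD1 0) //= affine_perm1 signs.
under eq_bigr => k k0 do rewrite rotations //.
rewrite sum_nat_const (_ : #|_| = 2); first by ring.
by rewrite -[RHS]/(3.-1) -[in RHS](card_ord 3) -(cardC1 (0 : 'I_3)); apply: eq_card.
Qed.

Corollary card_octcell_tiling_orbits :
  (#|orbit act_c [set: octa] @: [set: {ffun octcell -> T}]|%SET * 48 =
   t ^ 24 + 13 * t ^ 12 + 8 * t ^ 8 + 12 * t ^ 6 + 8 * t ^ 4
   + 6 * t ^ 10 * f ^ 4)%N.
Proof.
have card48 : #|[set: octa]%SET| = 48%N.
  by rewrite cardsT card_prod card_ffun card_bool card_ord card_Sn.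
rewrite -sum_fixed_tilings -{1}card48 -(Frobenius_Cauchy (to := act_c)).
  rewrite big_mkcond; apply: eq_bigr => g _; rewrite finset.in_setT.
  by congr #|pred_of_set _|; rewrite finset.setTI.
by apply/actsP => g _ tau; rewrite !finset.in_setT.
Qed.

End OctahedralCount.
(** * Intersections of finitely many half-spaces *)

Local Open Scope classical_set_scope.
Local Open Scope card_scope.
Local Open Scope ring_scope.

Section Convexity.
Variable R : realType.
Implicit Types (a b u v x y z n : 'cV[R]_3) (C S : set 'cV[R]_3).

Lemma dotvE u v : dotv u v = \sum_i u i 0 * v i 0.
Proof. by rewrite /dotv mxE; apply: eq_bigr => i _; rewrite mxE. Qed.

Lemma dotvDr u v v' : dotv u (v + v') = dotv u v + dotv u v'.
Proof. by rewrite /dotv mulmxDr mxE. Qed.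

Lemma dotvZr u k v : dotv u (k *: v) = k * dotv u v.
Proof. by rewrite /dotv -scalemxAr mxE. Qed.

Lemma dotvZl u k v : dotv (k *: u) v = k * dotv u v.
Proof. by rewrite /dotv linearZ -scalemxAl mxE. Qed.

Lemma dotvBr u v v' : dotv u (v - v') = dotv u v - dotv u v'.
Proof. by rewrite dotvDr -scaleN1r dotvZr mulN1r. Qed.

Lemma dotv_gt0 u : u != 0 -> 0 < dotv u u.
Proof.
move=> u0; rewrite dotvE lt_def sumr_ge0 ?andbT => [|i _]; last exact: sqr_ge0.
apply: contra u0 => /eqP/psumr_eq0P u2; apply/eqP/colP => i; rewrite mxE.
by apply/eqP; rewrite -sqrf_eq0 expr2 u2 // => j _; apply: sqr_ge0.
Qed.

Lemma convex_setP C :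
  convex_set C <-> (forall x y t, C x -> C y -> 0 <= t <= 1 ->
                     C (t *: x + (1 - t) *: y)).
Proof.
split=> [convC x y t Cx Cy /andP[t0 t1]|convC x y t].
  have := convC x y (Itv01 t0 t1); rewrite !inE => /(_ Cx Cy).
  by rewrite /conv /=.
by rewrite !inE => Cx Cy; apply: convC => //; rewrite ge0 le1.
Qed.

Lemma convex_hull S : convex_set (hull S).
Proof.
apply/convex_setP => x y t hx hy t01 C [convC SC].
by move/convex_setP: (convC); apply=> //; [apply: hx|apply: hy].
Qed.

Lemma hull_image (B : 'M[R]_3) S :
    (forall x, S x -> S (B *m x)) -> forall x, hull S x -> hull S (B *m x).
Proof.
move=> SB x; apply: (smallest_sub (X := [set x | hull S (B *m x)])).
  apply/convex_setP => y z t hy hz t01 /=; rewrite mulmxDr -!scalemxAr.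
  by move/convex_setP: (@convex_hull S); apply.
by move=> y /SB; apply: sub_gen_smallest.
Qed.

(** Adding in the cone over C keeps track of the total weight, so that longer
    combinations need no normalization by sums that may vanish. *)
Lemma convex_cone_add C x y s t :
    convex_set C -> C x -> C y -> 0 <= s -> 0 <= t ->
  exists2 z, C z & s *: x + t *: y = (s + t) *: z.
Proof.
move=> /convex_setP convC Cx Cy s0 t0.
have [/eqP|st0] := eqVneq (s + t) 0.
  rewrite paddr_eq0 // => /andP[/eqP -> /eqP ->].
  by exists x => //; rewrite !(addr0, scale0r).
have stp : 0 < s + t by rewrite lt_def st0 addr_ge0.
exists ((s / (s + t)) *: x + (1 - s / (s + t)) *: y).
  apply: convC => //; rewrite divr_ge0 ?addr_ge0 //=.
  by rewrite ler_pdivrMr // mul1r lerDl.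
rewrite scalerDr !scalerA; congr (_ *: _ + _ *: _); by field.
Qed.

Lemma convex_combination3 C x y z r s t :
    convex_set C -> C 0 -> C x -> C y -> C z ->
    0 <= r -> 0 <= s -> 0 <= t -> r + s + t <= 1 ->
  C (r *: x + s *: y + t *: z).
Proof.
move=> convC C0 Cx Cy Cz r0 s0 t0 rst.
have [u Cu ->] := convex_cone_add convC Cx Cy r0 s0.
have rs0 : 0 <= r + s by apply: addr_ge0.
have [v Cv ->] := convex_cone_add convC Cu Cz rs0 t0.
have := proj1 (convex_setP C) convC v 0 (r + s + t) Cv C0.
by rewrite scaler0 addr0; apply; rewrite rst addr_ge0.
Qed.

(** Three affinely independent points lie on a single plane. The vectors u that
    are constant on them form the row kernel of a 3 x 2 matrix of rank 2, which
    is a line; n is a nonzero vector of it, so a is a multiple of n. *)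
Lemma plane_unique a n (b : R) x y z :
    \rank (row_mx (y - x) (z - x)) = 2%N ->
    dotv n x = 1 -> dotv n y = 1 -> dotv n z = 1 ->
    dotv a x = b -> dotv a y = b -> dotv a z = b ->
  a = b *: n.
Proof.
set M := row_mx _ _ => rkM nx ny nz ax ay az.
have kerP u : dotv u x = dotv u y -> dotv u x = dotv u z -> (u^T <= kermx M)%MS.
  move=> uy uz; apply/sub_kermxP; rewrite mul_mx_row.
  have dot0 v : dotv u v = 0 -> u^T *m v = 0.
    by move=> uv; apply/matrixP => i j; rewrite !ord1 [RHS]mxE.
  by rewrite !dot0 ?row_mx0 // dotvBr -?uy -?uz subrr.
have n0 : n != 0.
  apply/eqP => n0; move: nx; rewrite n0 /dotv trmx0 mul0mx mxE => /eqP.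
  by rewrite eq_sym oner_eq0.
have rk_n : \rank n^T = 1%N.
  by apply/eqP; rewrite mxrank_tr eqn_leq rank_leq_col lt0n mxrank_eq0.
have nK : (n^T <= kermx M)%MS by apply: kerP; rewrite nx.
have aK : (a^T <= kermx M)%MS by apply: kerP; rewrite ax.
have Kn : (kermx M <= n^T)%MS.
  by rewrite -(mxrank_leqif_sup nK) rk_n mxrank_ker rkM.
have /sub_rVP[k ak] := submx_trans aK Kn.
have {}ak : a = k *: n by rewrite -[a]trmxK ak linearZ /= trmxK.
by move: ax; rewrite ak dotvZl nx mulr1 => ->.
Qed.

Definition spans_plane S : Prop :=
  exists x y z, [/\ S x, S y, S z & \rank (row_mx (y - x) (z - x)) = 2%N].

Section Polar.
Variables (I : finType) (n : I -> 'cV[R]_3).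

Definition polar : set 'cV[R]_3 := [set p | forall i, dotv (n i) p <= 1].

Definition facet i : set 'cV[R]_3 := [set p | polar p /\ dotv (n i) p = 1].

Lemma convex_polar : convex_set polar.
Proof.
apply/convex_setP => x y t Px Py t01 i; rewrite dotvDr !dotvZr.
have := Px i; have := Py i; nra.
Qed.

(** A point where all constraints are strict can be moved a little in any
    direction u. The bound on e comes from requiring that e * |n_i.u| stay below
    the slack 1 - n_i.p. *)
Lemma polar_interior p u : (forall i, dotv (n i) p < 1) ->
  exists2 e, 0 < e & polar (p + e *: u).
Proof.
move=> p_int; pose d i := (1 - dotv (n i) p) / (1 + `|dotv (n i) u|).
have nu_gt0 i : 0 < 1 + `|dotv (n i) u| by rewrite ltr_wpDr.
have d_gt0 i : 0 < d i by rewrite divr_gt0 ?subr_gt0.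
exists (\big[Order.min/1]_i d i); first by apply: lt_bigmin.
move=> i; rewrite dotvDr dotvZr.
set e := \big[_/_]_j _; have e_gt0 : 0 < e by apply: lt_bigmin.
have : e <= d i by apply: bigmin_le_cond.
rewrite ler_pdivlMr // => ed.
have := ler_norm (dotv (n i) u); nra.
Qed.

(** Let the supporting plane a.p = b touch the solid in affinely independent
    points x, y, z. Moving their centroid in the direction a would leave the
    half-space a.p <= b, so the centroid satisfies some constraint n_i with
    equality, and therefore so do x, y and z. Hence a = b n_i. *)
Lemma faces_polar F : faces polar F -> exists i, F = facet i.
Proof.
case=> -[a [b [a0 sup ->]]] [x [y [z [[Px ax] [Py ay] [Pz az] rk3]]]].
have no_interior p : dotv a p = b -> exists i, 1 <= dotv (n i) p.
  move=> ap; apply: contrapT => /forallNP pN.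
  have p_int i : dotv (n i) p < 1 by rewrite ltNge; apply/negP/pN.
  have [e e0 /sup] := polar_interior a p_int.
  by have := dotv_gt0 a0; rewrite dotvDr dotvZr ap; nra.
have b_gt0 : 0 < b.
  have [|e e0 /sup] := @polar_interior 0 a.
    by move=> i; rewrite /dotv mulmx0 mxE.
  by have := dotv_gt0 a0; rewrite add0r dotvZr; nra.
have [|i] := no_interior (3^-1 *: (x + y + z)).
  by rewrite dotvZr !dotvDr ax ay az; field.
rewrite dotvZr !dotvDr => ge1.
have := Px i; have := Py i; have := Pz i => nz ny nx.
have nE : [/\ dotv (n i) x = 1, dotv (n i) y = 1 & dotv (n i) z = 1].
  by split; lra.
case: nE => {}nx {}ny {}nz.
exists i; rewrite (plane_unique rk3 nx ny nz ax ay az).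
apply/seteqP; split=> p [Pp np]; split=> //; last by rewrite dotvZl np mulr1.
by apply: (mulfI (lt0r_neq0 b_gt0)); rewrite -dotvZl np mulr1.
Qed.

Lemma facet_face i :
  spans_plane (facet i) -> faces polar (facet i).
Proof.
move=> rk3; split=> //; exists (n i), 1; split=> //.
have [x [_ [_ [[_ nx] _ _ _]]]] := rk3; apply/eqP => n0.
by move: nx; rewrite n0 /dotv trmx0 mul0mx mxE => /eqP; rewrite eq_sym oner_eq0.
Qed.

Lemma facet_inj_normal i j :
  spans_plane (facet i) -> facet i = facet j -> n i = n j.
Proof.
move=> [x [y [z [Fx Fy Fz rk3]]]] Fij.
case: (Fx) (Fy) (Fz) => _ ix [_ iy] [_ iz].
move: Fx Fy Fz; rewrite Fij => -[_ jx] [_ jy] [_ jz].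
by rewrite -[RHS]scale1r; apply: plane_unique rk3 jx jy jz ix iy iz.
Qed.

End Polar.
End Convexity.
(** * The two solids and their facets *)

Section OctahedralSolid.
Variable R : realType.
Implicit Types (g h : octa) (x y : octcell) (u v p q : 'cV[R]_3).

Definition octmx g : 'M[R]_3 := diag_mx (\row_i (-1) ^+ g.1 i) *m perm_mx g.2.

Lemma octmx_mul m g (A : 'M[R]_(3, m)) i j :
  (octmx g *m A) i j = (-1) ^+ g.1 i * A (g.2 i) j.
Proof. by rewrite -mulmxA mul_diag_mx -row_permE !mxE. Qed.

Lemma octmxM g h : octmx (g * h)%g = octmx h *m octmx g.
Proof.
apply/matrixP => i j; rewrite octmx_mul -[octmx _]mulmx1 -[octmx g]mulmx1.
by rewrite !octmx_mul octaE1 signr_addb -mulrA octaE2 permM.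
Qed.

Lemma octmx1 : octmx 1%g = 1%:M.
Proof.
apply/matrixP => i j; rewrite -[octmx _]mulmx1 octmx_mul ffunE perm1.
by rewrite expr0 mul1r.
Qed.

Lemma octmxK g : cancel (mulmx (octmx g)) (@mulmx _ _ _ 1 (octmx g^-1%g)).
Proof. by move=> v; rewrite mulmxA -octmxM mulgV octmx1 mul1mx. Qed.

Lemma octmxVK g : cancel (@mulmx _ _ _ 1 (octmx g^-1%g)) (mulmx (octmx g)).
Proof. by move=> v; rewrite mulmxA -octmxM mulVg octmx1 mul1mx. Qed.

Lemma octmx_unit g : octmx g \in unitmx.
Proof.
have : octmx g *m octmx g^-1%g = 1%:M by rewrite -octmxM mulVg octmx1.
by case/mulmx1_unit.
Qed.

Lemma OhP A : Oh R A <-> exists g, A = octmx g.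
Proof.
split=> [[e [s ->]]|[[e s] ->]]; last by exists e, s.
exists ([ffun i => e i], s); congr (diag_mx _ *m _).
by apply/rowP => i; rewrite !mxE ffunE.
Qed.

Lemma dotv_octmx g u v : dotv (octmx g *m u) (octmx g *m v) = dotv u v.
Proof.
rewrite !dotvE [RHS](reindex_inj (@perm_inj _ g.2)); apply: eq_bigr => i _.
by rewrite !octmx_mul mulrACA -expr2 sqrr_sign mul1r.
Qed.

(** The submatrix on the rows i and j has the given minor as determinant. *)
Lemma rank_row_mx2 u v i j :
  u i 0 * v j 0 != u j 0 * v i 0 -> \rank (row_mx u v) = 2%N.
Proof.
move=> uv; apply/eqP; rewrite eqn_leq rank_leq_col /=.
pose f (k : 'I_2) := if k == 0 then i else j.
pose N : 'M[R]_2 := \matrix_(k, l) (if l == 0 then u else v) (f k) 0.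
have NE : N = rowsub f (row_mx u v).
  apply/matrixP => k l; rewrite !mxE; case: splitP => l' lE; rewrite !ord1 //=.
    by rewrite (_ : l = 0) //; apply: val_inj; rewrite /= lE ord1.
  by rewrite (_ : l == 0 = false) //; apply/negbTE; rewrite -val_eqE /= lE.
have rkN : \rank N = 2%N.
  apply/mxrank_unit; rewrite unitmxE unitfE (expand_det_row _ 0).
  rewrite !big_ord_recl big_ord0 /cofactor !det_mx11 !mxE /=.
  rewrite expr0 expr1 mul1r addr0 mulN1r mulrN subr_eq0.
  by rewrite [X in _ != X]mulrC.
by apply: leq_trans (eq_leq (esym rkN)) _; rewrite NE rowsubE mxrankM_maxr.
Qed.

Lemma dotv3 u v :
  dotv u v = u 0 0 * v 0 0 + u 1 0 * v 1 0 + u (1 + 1) 0 * v (1 + 1) 0.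
Proof.
rewrite dotvE !big_ord_recl big_ord0 addr0 addrA.
by congr (_ * _ + _ * _ + _ * _); congr (_ _ 0); apply: val_inj.
Qed.

(** Among the images of p choose one maximizing the product with (3, 2, 1):
    exchanging two neighbouring coordinates, or changing the sign of the last
    one, cannot increase this product further, which gives the three
    inequalities. *)
Lemma sorted_octmx p : exists g, let q := octmx g *m p in
  [/\ q 1 0 <= q 0 0, q (1 + 1) 0 <= q 1 0 & 0 <= q (1 + 1) 0].
Proof.
pose w : 'cV[R]_3 := vec3 3 2 1.
pose g := [arg max_(g > 1%g : octa) dotv w (octmx g *m p)]%O.
have g_max h : dotv w (octmx h *m (octmx g *m p)) <= dotv w (octmx g *m p).
  rewrite mulmxA -octmxM /g; case: Order.TotalTheory.arg_maxP => // k _ k_max.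
  exact: k_max.
exists g; move: (octmx g *m p) g_max => {g} q q_max /=.
have := q_max ([ffun=> false], tperm 0 1).
have := q_max ([ffun=> false], tperm 1 (1 + 1)).
have := q_max ([ffun i => i == 1 + 1], 1%g).
rewrite !dotv3 !octmx_mul !ffunE !mxE /= !perm1 !tpermL !tpermR !tpermD //.
by rewrite expr0 expr1 => ? ? ?; split; lra.
Qed.

Section Solid.
Variables alpha beta : R.

Definition face_normal x : 'cV[R]_3 :=
  \col_j ((-1) ^+ x.1 j * if j == x.2 then alpha else beta).

Definition solid := polar face_normal.

Lemma octmx_normal g x : octmx g *m face_normal x = face_normal (octcell_action x g).
Proof.
apply/colP => j; rewrite octmx_mul !mxE ffunE /= signr_addb mulrA.
by rewrite -(inj_eq (@perm_inj _ g.2) j) permKV.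
Qed.

Lemma normal_dual g x v :
  dotv (face_normal x) (octmx g *m v) = dotv (face_normal (octcell_action x g^-1%g)) v.
Proof. by rewrite -octmx_normal -(dotv_octmx g (octmx _ *m _)) octmxVK. Qed.

Lemma solid_octmx g v : solid v -> solid (octmx g *m v).
Proof. by move=> sv x; rewrite normal_dual. Qed.

Lemma mximg_facet g x :
  mximg (octmx g) (facet face_normal x) = facet face_normal (octcell_action x g).
Proof.
apply/seteqP; split=> [_ [v [sv nv] <-]|v [sv nv]].
  by split; [apply: solid_octmx | rewrite normal_dual actK].
exists (octmx g^-1%g *m v); last exact: octmxVK.
by split; [apply: solid_octmx | rewrite normal_dual invgK].
Qed.

Lemma facet_spans_plane_octmx g x :
  spans_plane (facet face_normal x) ->
  spans_plane (facet face_normal (octcell_action x g)).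
Proof.
move=> [p [q [r [xp xq xr rk3]]]].
exists (octmx g *m p), (octmx g *m q), (octmx g *m r).
have facet_g v : facet face_normal x v ->
    facet face_normal (octcell_action x g) (octmx g *m v).
  by move=> xv; rewrite -mximg_facet; exists v.
split; try exact: facet_g.
by rewrite -!mulmxBr -mul_mx_row eqmxMfull // row_full_unit octmx_unit.
Qed.

Lemma dotv_normal_le x v : 0 <= alpha -> 0 <= beta -> (forall j, 0 <= v j 0) ->
  dotv (face_normal x) v <= dotv (face_normal ([ffun=> false], x.2)) v.
Proof.
move=> a0 b0 v0; rewrite !dotvE; apply: ler_sum => j _.
rewrite ler_wpM2r // !mxE ffunE expr0 mul1r -[leRHS]mul1r ler_wpM2r //.
  by case: ifP.
by case: (x.1 j); rewrite ?expr0 ?expr1 // lerN10.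
Qed.

Lemma solid_positive v : 0 <= alpha -> 0 <= beta -> (forall j, 0 <= v j 0) ->
    (forall i, dotv (face_normal ([ffun=> false], i)) v <= 1) ->
  solid v.
Proof. by move=> a0 b0 v0 nv x; apply: le_trans (nv x.2); apply: dotv_normal_le. Qed.

Lemma dotv_normal_vec3 i (a b c : R) :
  dotv (face_normal ([ffun=> false], i)) (vec3 a b c) =
  (if i == 0 then alpha else beta) * a + (if i == 1 then alpha else beta) * b +
  (if i == 1 + 1 then alpha else beta) * c.
Proof.
rewrite dotv3 !mxE !ffunE !expr0 !mul1r /=.
by elim/ord3_ind: i.
Qed.

Lemma solid_vec3 (k a b c : R) : 0 <= alpha -> 0 <= beta ->
    0 <= k -> 0 <= a -> 0 <= b -> 0 <= c ->
    k * (alpha * a + beta * b + beta * c) <= 1 ->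
    k * (beta * a + alpha * b + beta * c) <= 1 ->
    k * (beta * a + beta * b + alpha * c) <= 1 ->
  solid (k *: vec3 a b c).
Proof.
move=> al0 be0 k0 a0 b0 c0 n0 n1 n2; apply: solid_positive => // [j|i].
  by rewrite !mxE mulr_ge0 //; case: j => [[|[|[|]]]].
by rewrite dotvZr dotv_normal_vec3; elim/ord3_ind: i.
Qed.

(** The points c1 (1,0,0), c2 (1,1,0), c3 (1,1,1) lie on the plane of the facet
    x. A sorted point q is a combination of them with nonnegative weights, whose
    sum is face_normal x . q, at most 1 on the solid; the missing weight goes
    to 0. *)
Lemma solid_sub C x c1 c2 c3 :
    convex_set C -> C 0 -> (forall g v, C v -> C (octmx g *m v)) ->
    0 < c1 -> 0 < c2 -> 0 < c3 ->
    dotv (face_normal x) (c1 *: vec3 1 0 0) = 1 -> C (c1 *: vec3 1 0 0) ->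
    dotv (face_normal x) (c2 *: vec3 1 1 0) = 1 -> C (c2 *: vec3 1 1 0) ->
    dotv (face_normal x) (c3 *: vec3 1 1 1) = 1 -> C (c3 *: vec3 1 1 1) ->
  solid `<=` C.
Proof.
move=> convC C0 Cg c1_gt0 c2_gt0 c3_gt0 n1 C1 n2 C2 n3 C3 p Pp.
have [g /= [q10 q21 q2]] := sorted_octmx p.
rewrite -(octmxK g p); apply: Cg.
have Pq := solid_octmx g Pp; move: (octmx g *m p) Pq q10 q21 q2 => q Pq q10 q21 q2.
have qE : q = ((q 0 0 - q 1 0) / c1) *: (c1 *: vec3 1 0 0) +
              ((q 1 0 - q (1 + 1) 0) / c2) *: (c2 *: vec3 1 1 0) +
              (q (1 + 1) 0 / c3) *: (c3 *: vec3 1 1 1).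
  rewrite !scalerA !divfK ?lt0r_neq0 //; apply/colP => j.
  by rewrite !mxE; elim/ord3_ind: j => /=; ring.
rewrite qE; apply: convex_combination3 => //.
- by rewrite divr_ge0 ?subr_ge0 // ltW.
- by rewrite divr_ge0 ?subr_ge0 // ltW.
- by rewrite divr_ge0 // ltW.
have := Pq x; rewrite {1}qE !dotvDr.
rewrite (dotvZr _ ((q 0 0 - q 1 0) / c1)) n1.
rewrite (dotvZr _ ((q 1 0 - q (1 + 1) 0) / c2)) n2.
by rewrite (dotvZr _ (q (1 + 1) 0 / c3)) n3 !mulr1.
Qed.

Hypotheses (a_gt0 : 0 < alpha) (b_gt0 : 0 < beta) (ab : alpha != beta).

(** The absolute value of a coordinate tells the axis because alpha and beta
    differ. *)
Lemma face_normal_inj : injective face_normal.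
Proof.
have nE x j : face_normal x j 0 = (-1) ^+ x.1 j * if j == x.2 then alpha else beta.
  by rewrite mxE.
have n_gt0 x j : 0 < (if j == x.2 then alpha else beta) by case: ifP.
have norm_n x j : `|face_normal x j 0| = if j == x.2 then alpha else beta.
  by rewrite nE normrMsign gtr0_norm.
have sgn_n x j : Num.sg (face_normal x j 0) = (-1) ^+ x.1 j.
  by rewrite nE sgrM sgrX sgrN1 (gtr0_sg (n_gt0 x j)) mulr1.
move=> [d i] [d' i'] nn; congr pair.
  apply/ffunP => j; have := sgn_n (d, i) j; rewrite nn sgn_n /=.
  by move/signr_inj.
have := norm_n (d, i) i; rewrite nn norm_n /= eqxx.
by case: eqP => // _ /eqP; rewrite eq_sym (negbTE ab).
Qed.

(** By symmetry take the face with normal (alpha, beta, beta). Besides a multiple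
    of (1,1,1), it contains multiples of (0,1,0) and (0,0,1) when alpha < beta
    (a triangle of the triakis octahedron), and of (1,1,0) and (1,0,1) when
    beta < alpha (a kite of the deltoidal icositetrahedron). *)
Lemma facet_spans_plane x : spans_plane (facet face_normal x).
Proof.
have [g <-] := octcell_trans ([ffun=> false], 0) x; apply: facet_spans_plane_octmx.
have a_ge0 := ltW a_gt0; have b_ge0 := ltW b_gt0.
have facetP (k a b c : R) : solid (k *: vec3 a b c) ->
    k * (alpha * a + beta * b + beta * c) = 1 ->
    facet face_normal ([ffun=> false], 0) (k *: vec3 a b c).
  by move=> sv nv; split=> //; rewrite dotvZr dotv_normal_vec3.
have s_gt0 : 0 < alpha + beta + beta by rewrite !addr_gt0.
have t_gt0 : 0 < alpha + beta by rewrite addr_gt0.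
have s_unit : (alpha + beta + beta)^-1 * (alpha + beta + beta) = 1.
  by rewrite mulVf // lt0r_neq0.
have t_unit : (alpha + beta)^-1 * (alpha + beta) = 1 by rewrite mulVf ?lt0r_neq0.
have s_inv : 0 < (alpha + beta + beta)^-1 by rewrite invr_gt0.
have t_inv : 0 < (alpha + beta)^-1 by rewrite invr_gt0.
have b_inv : 0 < beta^-1 by rewrite invr_gt0.
have b_unit : beta^-1 * beta = 1 by rewrite mulVf ?lt0r_neq0.
have rF : facet face_normal ([ffun=> false], 0)
                ((alpha + beta + beta)^-1 *: vec3 1 1 1).
  by apply: facetP; [apply: solid_vec3 => //; nra | nra].
case: (ltgtP alpha beta) ab => // ab' _.
  exists ((alpha + beta + beta)^-1 *: vec3 1 1 1), (beta^-1 *: vec3 0 1 0),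
    (beta^-1 *: vec3 0 0 1); split=> //.
  - by apply: facetP; [apply: solid_vec3 => //; nra | nra].
  - by apply: facetP; [apply: solid_vec3 => //; nra | nra].
  apply: (@rank_row_mx2 _ _ 0 1); rewrite !mxE /= -subr_eq0.
  rewrite (_ : _ - _ = beta^-1 * (alpha + beta + beta)^-1).
    by rewrite mulf_neq0 ?lt0r_neq0.
  by ring.
exists ((alpha + beta + beta)^-1 *: vec3 1 1 1),
  ((alpha + beta)^-1 *: vec3 1 1 0), ((alpha + beta)^-1 *: vec3 1 0 1).
split=> //.
- by apply: facetP; [apply: solid_vec3 => //; nra | nra].
- by apply: facetP; [apply: solid_vec3 => //; nra | nra].
apply: (@rank_row_mx2 _ _ 1 (1 + 1)); rewrite !mxE /= -subr_eq0.
rewrite (_ : _ - _ = - (alpha * (alpha + beta)^-1 ^+ 2 * (alpha + beta + beta)^-1)).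
  by rewrite oppr_eq0 !mulf_neq0 ?lt0r_neq0 ?expf_neq0 ?lt0r_neq0.
by field; rewrite !lt0r_neq0.
Qed.

End Solid.

Lemma Oh_orbit_sub (S : set 'cV[R]_3) v :
  (forall g p, S p -> S (octmx g *m p)) -> S v -> Oh_orbit v `<=` S.
Proof. by move=> Sg Sv _ [A /OhP[g ->] <-]; apply: Sg. Qed.

Lemma Oh_orbit_octmx v g p : Oh_orbit v p -> Oh_orbit v (octmx g *m p).
Proof.
move=> [A /OhP[h ->] <-]; exists (octmx (h * g)%g); first by apply/OhP; exists (h * g)%g.
by rewrite octmxM mulmxA.
Qed.

Lemma Oh_orbit_refl v : Oh_orbit v v.
Proof. by exists 1%:M; [apply/OhP; exists 1%g; rewrite octmx1 | rewrite mul1mx]. Qed.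

(** The origin is the midpoint of v and -v. *)
Lemma hull_octmx_0 (S : set 'cV[R]_3) v :
  (forall g p, S p -> S (octmx g *m p)) -> S v -> hull S 0.
Proof.
move=> Sg Sv; pose g : octa := ([ffun=> true], 1%g).
have gv : octmx g *m v = - v.
  by apply/colP => i; rewrite octmx_mul ffunE perm1 !mxE expr1 mulN1r.
have -> : 0 = 2^-1 *: v + (1 - 2^-1) *: (octmx g *m v) :> 'cV[R]_3.
  by rewrite gv scalerN -scalerBl (_ : _ - _ = 0) ?scale0r //; field.
apply: (proj1 (convex_setP _) (@convex_hull _ S)).
- exact: sub_gen_smallest.
- by apply: sub_gen_smallest; apply: Sg.
by rewrite invr_ge0 ler0n invf_le1 // ler1n.
Qed.

Lemma sqrt2_bounds : let y : R := Num.sqrt 2 - 1 in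
  [/\ 0 < y, y < 1 & y * (y + 2) = 1].
Proof.
have s_ge0 := sqrtr_ge0 (2 : R).
have s2 : Num.sqrt (2 : R) ^+ 2 = 2 by rewrite sqr_sqrtr.
by split; nra.
Qed.

Lemma triakis_octahedronE : triakis_octahedron R = solid (Num.sqrt 2 - 1) 1.
Proof.
have [] := sqrt2_bounds; rewrite /triakis_octahedron.
set y := Num.sqrt 2 - 1 => y0 y1 yE.
set V := (X in hull X).
have Vg g p : V p -> V (octmx g *m p).
  by case=> Vp; [left | right]; apply: Oh_orbit_octmx.
have Ve1 : V (vec3 1 0 0) by left; apply: Oh_orbit_refl.
have Vc : V (y *: vec3 1 1 1) by right; apply: Oh_orbit_refl.
apply/seteqP; split.
  apply: smallest_sub; first exact: convex_polar.
  rewrite subUset; split; apply: Oh_orbit_sub; try exact: solid_octmx.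
    by rewrite -[vec3 _ _ _]scale1r; apply: solid_vec3; nra.
  by apply: solid_vec3; nra.
have Ve2 : V (vec3 0 1 0).
  rewrite (_ : vec3 _ _ _ = octmx ([ffun=> false], tperm 0 1) *m vec3 1 0 0).
    exact: Vg.
  apply/colP => j; rewrite octmx_mul !mxE ffunE expr0 mul1r.
  by elim/ord3_ind: j; rewrite /= ?tpermL ?tpermR ?tpermD.
(* The chosen facet has normal (1, 1, y); its plane meets the direction (1,1,0)
   at the midpoint of two vertices. *)
apply: (@solid_sub _ _ _ ([ffun=> false], 1 + 1) 1 2^-1 y) => //.
- exact: convex_hull.
- exact: hull_octmx_0 Ve1.
- by move=> g v; apply: hull_image => p; apply: Vg.
- by rewrite dotvZr dotv_normal_vec3 /=; lra.
- by rewrite scale1r; apply: sub_gen_smallest.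
- by rewrite dotvZr dotv_normal_vec3 /=; lra.
- rewrite (_ : _ *: _ = 2^-1 *: vec3 1 0 0 + (1 - 2^-1) *: vec3 0 1 0).
    by apply: (proj1 (convex_setP _) (@convex_hull _ V));
      [exact: sub_gen_smallest | exact: sub_gen_smallest | lra].
  by apply/colP => j; rewrite !mxE; elim/ord3_ind: j => /=; lra.
- by rewrite dotvZr dotv_normal_vec3 /=; lra.
- exact: sub_gen_smallest.
Qed.

Lemma deltoidal_icositetrahedronE :
  deltoidal_icositetrahedron R = solid 1 (Num.sqrt 2 - 1).
Proof.
have [] := sqrt2_bounds; rewrite /deltoidal_icositetrahedron.
set y := Num.sqrt 2 - 1 => y0 y1 yE.
set m := Num.sqrt 2 / 2; set c := (2 * Num.sqrt 2 + 1) / 7.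
have sE : Num.sqrt 2 = y + 1 by rewrite subrK.
have mE : m = (y + 1) / 2 by rewrite /m sE.
have cE : c = (2 * y + 3) / 7 by rewrite /c sE; lra.
have m_inv : m * (1 + y) = 1 by rewrite mE; nra.
have c_inv : c * (1 + y + y) = 1 by rewrite cE; nra.
have m_gt0 : 0 < m by rewrite mE; lra.
have c_gt0 : 0 < c by rewrite cE; lra.
set V := (X in hull X).
have Vg g p : V p -> V (octmx g *m p).
  by case=> [[]|] Vp; [left; left | left; right | right]; apply: Oh_orbit_octmx.
have Ve : V (vec3 1 0 0) by left; left; apply: Oh_orbit_refl.
have Vc : V (c *: vec3 1 1 1) by left; right; apply: Oh_orbit_refl.
have Vm : V (m *: vec3 1 1 0) by right; apply: Oh_orbit_refl.
apply/seteqP; split.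
  apply: smallest_sub; first exact: convex_polar.
  rewrite !subUset; split; first split.
  - apply: Oh_orbit_sub; first exact: solid_octmx.
    by rewrite -[vec3 _ _ _]scale1r; apply: solid_vec3; nra.
  - by apply: Oh_orbit_sub; [exact: solid_octmx | apply: solid_vec3; nra].
  - by apply: Oh_orbit_sub; [exact: solid_octmx | apply: solid_vec3; nra].
(* The chosen facet has normal (1, y, y), and all three points are vertices. *)
apply: (@solid_sub _ _ _ ([ffun=> false], 0) 1 m c) => //.
- exact: convex_hull.
- exact: hull_octmx_0 Ve.
- by move=> g v; apply: hull_image => p; apply: Vg.
- by rewrite dotvZr dotv_normal_vec3 /=; lra.
- by rewrite scale1r; apply: sub_gen_smallest.
- by rewrite dotvZr dotv_normal_vec3 /=; lra.
- exact: sub_gen_smallest.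
- by rewrite dotvZr dotv_normal_vec3 /=; lra.
- exact: sub_gen_smallest.
Qed.

End OctahedralSolid.
(** * From tilings of the solids to tilings of cells *)

Section SolidTilings.
Variables (R : realType) (alpha beta : R).
Hypotheses (a_gt0 : 0 < alpha) (b_gt0 : 0 < beta) (ab : alpha != beta).

Local Notation P := (solid alpha beta).

Lemma face_facet x : faces P (facet (face_normal alpha beta) x).
Proof. by apply: facet_face; apply: facet_spans_plane. Qed.

Definition octface x : faces P := SigSub (mem_set (face_facet x)).

Lemma octface_inj : injective octface.
Proof.
move=> x y xy; have /(congr1 val)/= Fxy := xy.
apply: (@face_normal_inj R alpha beta) => //.
by apply: facet_inj_normal Fxy; apply: facet_spans_plane.
Qed.

Lemma octface_surj (F : faces P) : exists x, F = octface x.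
Proof.
have /set_mem/faces_polar[x Fx] := valP F.
by exists x; apply: val_inj.
Qed.

Lemma octface_mximg g x (F : faces P) :
  val F = mximg (octmx R g) (val (octface x)) <-> F = octface (octcell_action x g).
Proof.
split=> [FE|->]; last by rewrite /= mximg_facet.
by apply: val_inj; rewrite FE /= mximg_facet.
Qed.

(** If the identity reflected the face in a line, every point of the face would
    be its own midpoint and lie on that line, but a face spans a plane. *)
Lemma reflects_face_neq1 x g :
  reflects_face (val (octface x)) (octmx R g) -> g != 1%g.
Proof.
case=> _ [p0 [u [_ _ on_line]]]; apply/eqP => g1.
have lineP v : facet (face_normal alpha beta) x v -> exists k, v = p0 + k *: u.
  move=> /on_line[_]; rewrite g1 octmx1 mul1mx -mulr2n -scaler_nat scalerA.
  by rewrite mulVf ?scale1r // pnatr_eq0.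
have [_ [_ [_ [/lineP[k ->] /lineP[l ->] /lineP[m ->]]]]] :=
  facet_spans_plane a_gt0 b_gt0 ab x.
have -> : row_mx (p0 + l *: u - (p0 + k *: u)) (p0 + m *: u - (p0 + k *: u)) =
          u *m row_mx (l - k)%:M (m - k)%:M.
  rewrite mul_mx_row !mul_mx_scalar !scalerBl.
  by congr row_mx; rewrite opprD addrACA subrr add0r.
move=> rk2; have := mxrankM_maxl u (row_mx (l - k)%:M (m - k)%:M : 'M_(1, 1 + 1)).
by rewrite rk2 leqNgt ltnS rank_leq_col.
Qed.

Variables (T : finType) (D : tile_designs (Oh R) P T).

Lemma Oh_octmx g : Oh R (octmx R g). Proof. by apply/OhP; exists g. Qed.

Let moved g x t := (design_act D (octmx R g) (t, octface x)).1.

Let design_octface g x t :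
  design_act D (octmx R g) (t, octface x) =
  (moved g x t, octface (octcell_action x g)).
Proof.
rewrite [LHS]surjective_pairing; congr pair; apply/octface_mximg.
by rewrite (design_act_over D) //; apply: Oh_octmx.
Qed.

Let moved1 x t : moved 1%g x t = t.
Proof. by rewrite /moved octmx1 design_act1. Qed.

Let movedM g h x t :
  moved (g * h)%g x t = moved h (octcell_action x g) (moved g x t).
Proof.
by rewrite /moved octmxM design_actM ?design_octface //; apply: Oh_octmx.
Qed.

(** The tile designs read on cells, through the bijection of cells and faces. *)
Definition design_cocycle : cocycle T octcell_action := Cocycle moved1 movedM.

Let act := tiling_action design_cocycle.

Let pull (tau : faces P -> T) : {ffun octcell -> T} :=
  [ffun x => tau (octface x)].

Lemma moves_octmx g (tau tau' : faces P -> T) :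
  moves D (octmx R g) tau tau' <-> pull tau' == act (pull tau) g.
Proof.
split=> [mv|/tiling_actP mv F F'].
  apply/tiling_actP => x; rewrite !ffunE.
  have := mv (octface x) (octface (octcell_action x g)).
  by rewrite design_octface => /(_ (proj2 (octface_mximg _ _ _) erefl)) [].
have [x ->] := octface_surj F => /octface_mximg ->.
by rewrite design_octface; have := mv x; rewrite !ffunE => ->.
Qed.

Lemma pull_surj (tau : {ffun octcell -> T}) : exists tau', pull tau' = tau.
Proof.
have /choice[idx idxE] := octface_surj.
exists (tau \o idx); apply/ffunP => x; rewrite ffunE /=; congr (tau _).
by apply: octface_inj; rewrite -idxE.
Qed.

Lemma tiling_orbitE tau :
  tiling_orbit D tau = [set tau' | pull tau' \in orbit act [set: octa]%SET (pull tau)].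
Proof.
apply/seteqP; split=> [tau' [A /OhP[g ->] /moves_octmx/eqP tau'E]|tau'] /=.
  by rewrite tau'E mem_orbit ?finset.in_setT.
case/orbitP => g _ gE; exists (octmx R g); first exact: Oh_octmx.
by apply/moves_octmx; rewrite -gE.
Qed.

(** Tilings of the faces and of the cells correspond, and so do their orbits;
    an orbit of face tilings is enumerated by its preimage among the finitely
    many orbits of cell tilings. *)
Lemma card_tiling_orbits :
  tiling_orbits D #=
    `I_#|orbit act [set: octa]%SET @: [set: {ffun octcell -> T}]%SET|.
Proof.
set orbits := orbit _ _ @: _.
pose J k : set (faces P -> T) := [set tau | pull tau \in nth finset.set0 (enum orbits) k].
have orbitsE : tiling_orbits D = J @` `I_#|orbits|.
  apply/seteqP; split=> [_ [tau _ <-]|_ [k k_lt <-]].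
    have O_in : orbit act [set: octa]%SET (pull tau) \in enum orbits.
      by rewrite mem_enum imset_f.
    exists (index (orbit act [set: octa]%SET (pull tau)) (enum orbits)).
      by rewrite /= cardE index_mem.
    by rewrite tiling_orbitE /J nth_index.
  have : nth finset.set0 (enum orbits) k \in orbits.
    by rewrite -mem_enum mem_nth // -cardE.
  case/imsetP => tau _ kE; have [tau' tau'E] := pull_surj tau.
  by exists tau' => //; rewrite tiling_orbitE /J kE tau'E.
rewrite orbitsE; apply: inj_card_eq => k l; rewrite !inE /= => k_lt l_lt JE.
apply/eqP; rewrite -(nth_uniq finset.set0 _ _ (enum_uniq orbits)) -?cardE //.
apply/eqP/setP => tau; have [tau' <-] := pull_surj tau.
by have /seteqP[kl lk] := JE; apply/idP/idP => [/kl|/lk].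
Qed.

Variables (F : faces P) (f : 'M[R]_3).
Hypotheses (hf : Oh R f) (hfF : reflects_face (val F) f).

(** The given f is the nontrivial element stabilizing F; transitivity carries it
    to the only nontrivial element stabilizing x. *)
Lemma num_fixed_stabilizer x g : g != 1%g -> octcell_action x g = x ->
  #|[pred t | design_cocycle g x t == t]| = num_fixed D F f.
Proof.
move: hf hfF => /OhP[g0 ->]; have [x0 ->] := octface_surj F => refl.
have g0_neq1 := reflects_face_neq1 refl.
have x0g0 : octcell_action x0 g0 = x0.
  by apply: octface_inj; symmetry; apply/octface_mximg; case: refl.
move=> g_neq1 xg; have [h xE] := octcell_trans x0 x.
transitivity #|[pred t | design_cocycle g0 x0 t == t]|; last first.
  apply: eq_card => t; rewrite !inE design_octface x0g0.
  by apply/eqP/eqP => [e|[e]] //; congr pair.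
rewrite (card_fixed_designs_conj design_cocycle h x0g0) xE.
rewrite (@octcell_stab_unique x g (g0 ^ h)%g) //.
  by rewrite -xE conjgE !actM actK x0g0.
by rewrite conjg_eq1.
Qed.

End SolidTilings.

Theorem theorem7 (R : realType) (P : set 'cV[R]_3)
  (hP : P = triakis_octahedron R \/ P = deltoidal_icositetrahedron R)
  (T : finType) (D : tile_designs (Oh R) P T)
  (F : faces P) (f : 'M[R]_3) (hf : Oh R f) (hfF : reflects_face (val F) f)
  (tid tf : nat) (htid : #|T| = tid) (htf : num_fixed D F f = tf) :
  exists N : nat,
    [/\ tiling_orbits D #= `I_N,
        N%:R = 1 / 48 *
          (tid%:R ^+ 24 + 6 * tid%:R ^+ 6 + 3 * tid%:R ^+ 12 + 8 * tid%:R ^+ 8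
           + 6 * tid%:R ^+ 12 + tid%:R ^+ 12 + 6 * tid%:R ^+ 6
           + 3 * tid%:R ^+ 12 + 8 * tid%:R ^+ 4
           + 6 * tid%:R ^+ 10 * tf%:R ^+ 4) :> rat
      & 1 / 48 *
          (tid%:R ^+ 24 + 6 * tid%:R ^+ 6 + 3 * tid%:R ^+ 12 + 8 * tid%:R ^+ 8
           + 6 * tid%:R ^+ 12 + tid%:R ^+ 12 + 6 * tid%:R ^+ 6
           + 3 * tid%:R ^+ 12 + 8 * tid%:R ^+ 4
           + 6 * tid%:R ^+ 10 * tf%:R ^+ 4)
        = 1 / 48 *
          (tid%:R ^+ 24 + 13 * tid%:R ^+ 12 + 8 * tid%:R ^+ 8
           + 12 * tid%:R ^+ 6 + 8 * tid%:R ^+ 4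
           + 6 * tid%:R ^+ 10 * tf%:R ^+ 4) :> rat].
Proof.
have [y_gt0 y_lt1 _] := sqrt2_bounds R.
have [al [be [a_gt0 b_gt0 ab PE]]] : exists al be : R,
    [/\ 0 < al, 0 < be, al != be & P = solid al be].
  case: hP => ->.
    by exists (Num.sqrt 2 - 1), 1; rewrite triakis_octahedronE lt_eqF.
  by exists 1, (Num.sqrt 2 - 1); rewrite deltoidal_icositetrahedronE gt_eqF.
subst P tid tf; move: (card_tiling_orbits a_gt0 b_gt0 ab D).
set N := #|_| => cardN; exists N.
have := card_octcell_tiling_orbits (num_fixed_stabilizer a_gt0 b_gt0 ab D hf hfF).
rewrite -/N => /(congr1 (fun n => n%:R : rat)).
rewrite !(natrD, natrM, natrX) => NE.
split=> //; last by field.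
have -> : N%:R = 1 / 48 * (N%:R * 48) :> rat by field.
by rewrite NE; congr (_ * _); ring.
Qed.
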